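(* Let $\Omega\subset\mathbb{R}^2$ be a bounded, $C^\infty$-smooth, strictly convex domain with torsion function $u$, and let $M=\max_\Omega u$. Let $\phi$ be an Airy potential for $\Omega$ and $X=-\nabla\phi$. Fix $e\in\mathbb{S}^1$ and use the positively oriented orthonormal coordinates $(x,y)$ with respect to the basis $(e,Je)$. Let $(a,b)$ be the projection of $\Omega$ on the $x$-axis and, for $a<x<b$, put $$v(x)=\max\{u(x,y):(x,y)\in\Omega\},$$ let $y(x)$ be the unique $y$ with $(x,y)\in\Omega$ at which this maximum is attained, and set $$z(x)=X(x,y(x))\cdot e .$$ Then $z$ is locally Lipschitz on $(a,b)$ and $$z'(x)=2v(x)-v'(x)^2\quad\text{for a.e. }x\in(a,b).$$ Moreover, $z$ is $2M$-Lipschitz on $(a,b)$ and extends continuously to $[a,b]$.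
   Context: The torsion function $u\in H_0^1(\Omega)$ solves $-\Delta u=1$ in $\Omega$, $u=0$ on $\partial\Omega$; for smooth $\Omega$, $u\in C^\infty(\overline\Omega)$. Strictly convex means that $\partial\Omega$ contains no nondegenerate line segment. $J$ is counterclockwise rotation by $\pi/2$. With $$\Sigma=(|\nabla u|^2-2u)\,\mathrm{Id}-2\,\nabla u\otimes\nabla u ,$$ an Airy potential is a function $\phi\in C^\infty(\overline\Omega)$ with $\Sigma=J^TD^2\phi\,J$ in $\Omega$; it exists and is unique up to adding affine functions. The fiberwise maximizer $y(x)$ exists and is unique for each $x\in(a,b)$ (this uses the known fact that $\sqrt u$ is concave), and $\sqrt v$ is concave on $(a,b)$, so that $v$ is differentiable almost everywhere. *)

(* Defs.v *)
From HB Require Import structures.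
From mathcomp Require Import all_boot all_order all_algebra.
From mathcomp Require Import all_classical all_reals all_analysis.

Set Implicit Arguments.
Unset Strict Implicit.
Unset Printing Implicit Defensive.

Import Order.TTheory GRing.Theory Num.Theory.
Import numFieldNormedType.Exports.

Local Open Scope classical_set_scope.
Local Open Scope ring_scope.

(* Points and vectors of the plane are column vectors ['cV[R]_2].  Their library
   norm is the sup norm; it only serves for the topology, and Euclidean
   quantities are expressed through [dotp]. *)

Definition dotp (R : realType) (p q : 'cV[R]_2) : R := \sum_i p i 0 * q i 0.

(* J (1, 0) = (0, 1) and J (0, 1) = (-1, 0). *)
Definition rotJ (R : realType) : 'M[R]_2 := delta_mx 1 0 - delta_mx 0 1.

Definition frame (R : realType) (e : 'cV[R]_2) (x y : R) : 'cV[R]_2 :=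
  x *: e + y *: (rotJ R *m e).

Definition partial (R : realType) (i : 'I_2) (f : 'cV[R]_2 -> R) :
    'cV[R]_2 -> R :=
  fun p => 'D_(delta_mx i 0) f p.

Definition grad (R : realType) (f : 'cV[R]_2 -> R) (p : 'cV[R]_2) : 'cV[R]_2 :=
  \col_i partial i f p.

Definition hess (R : realType) (f : 'cV[R]_2 -> R) (p : 'cV[R]_2) : 'M[R]_2 :=
  \matrix_(i, j) partial i (partial j f) p.

Definition laplacian (R : realType) (f : 'cV[R]_2 -> R) (p : 'cV[R]_2) : R :=
  \tr (hess f p).

(* C^oo on the whole plane: all iterated partial derivatives are Frechet
   differentiable, hence continuous, everywhere. *)
Definition smooth (R : realType) (f : 'cV[R]_2 -> R) : Prop :=
  forall (s : seq 'I_2) (p : 'cV[R]_2), differentiable (foldr (@partial R) f s) p.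

(* C^oo (closure A), as restrictions of functions that are C^oo on the plane;
   the values of [f] outside [closure A] are irrelevant. *)
Definition smooth_closure (R : realType) (A : set 'cV[R]_2)
    (f : 'cV[R]_2 -> R) : Prop :=
  exists2 g : 'cV[R]_2 -> R, smooth g & {in closure A, f =1 g}.

Definition boundary (R : realType) (A : set 'cV[R]_2) : set 'cV[R]_2 :=
  closure A `\` interior A.

Definition domain (R : realType) (A : set 'cV[R]_2) : Prop :=
  [/\ open A, A !=set0 & connected A].

(* Near each boundary point, A is the sublevel set of a local defining function
   with nonvanishing gradient. *)
Definition smooth_domain (R : realType) (A : set 'cV[R]_2) : Prop :=
  domain A /\
  forall p, boundary A p ->
    exists rho : 'cV[R]_2 -> R,
      [/\ smooth rho, rho p = 0, grad rho p != 0 &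
          \forall q \near p, A q <-> rho q < 0].

Definition strictly_convex (R : realType) (A : set 'cV[R]_2) : Prop :=
  convex_set A /\
  forall p q : 'cV[R]_2,
    (forall t : R, 0 <= t <= 1 -> boundary A ((1 - t) *: p + t *: q)) -> p = q.

(* On a bounded smooth domain the H^1_0 solution of the torsion problem is C^oo
   up to the boundary, i.e. it is the classical solution described here. *)
Definition torsion_function (R : realType) (A : set 'cV[R]_2)
    (u : 'cV[R]_2 -> R) : Prop :=
  [/\ smooth_closure A u,
      forall p, A p -> - laplacian u p = 1 &
      forall p, boundary A p -> u p = 0].

Definition stress (R : realType) (u : 'cV[R]_2 -> R) (p : 'cV[R]_2) : 'M[R]_2 :=
  (dotp (grad u p) (grad u p) - 2 * u p)%:M
  - 2 *: (grad u p *m (grad u p)^T).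

Definition airy_potential (R : realType) (A : set 'cV[R]_2)
    (u phi : 'cV[R]_2 -> R) : Prop :=
  smooth_closure A phi /\
  forall p, A p -> stress u p = (rotJ R)^T *m hess phi p *m rotJ R.

Definition is_max (R : realType) (S : set R) (m : R) : Prop :=
  S m /\ ubound S m.

(* Main.v *)
Require Import Defs.
From HB Require Import structures.
From mathcomp Require Import all_boot all_order all_algebra.
From mathcomp Require Import all_classical all_reals all_analysis.
From mathcomp Require Import ring lra.

Set Implicit Arguments.
Unset Strict Implicit.
Unset Printing Implicit Defensive.

Import Order.TTheory GRing.Theory Num.Theory.
Import numFieldNormedType.Exports.

Local Open Scope classical_set_scope.
Local Open Scope ring_scope.

(* On the ridge, the set of the points [(x, y x)], the derivative of [u] in the
   direction [f = J e] vanishes.  The stress equation reads, in the frame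
   [(e, f)], [phi_xx = u_x^2 - u_y^2 - 2 u] and [phi_xy = 2 u_x u_y], so that
   formally [z' = - phi_xx - phi_xy y' = 2 v - v'^2].  This holds at every point
   although [y] is only known to be continuous: by the intermediate value
   theorem each height between [y x] and [y (x + h)] is the height of a ridge
   point over [[x, x + h]], so [u_y = O(h)] on the vertical segment between the
   two heights, whose contribution to the increment of [z] is thus [o(h)].
   The Lipschitz constant comes from [u_x^2 <= 2 (M - u)] on the ridge, obtained
   from the maximum principle by comparing [u] with a parabola in [x]. *)

(** * Functions of the plane and of the line *)

Lemma dotpE (R : realType) (p q : 'cV[R]_2) :
  dotp p q = p 0 0 * q 0 0 + p 1 0 * q 1 0.
Proof.
rewrite /dotp !big_ord_recl big_ord0 addr0.
by congr (_ + p _ 0 * q _ 0); apply: val_inj.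
Qed.

Lemma dotpC (R : realType) (p q : 'cV[R]_2) : dotp p q = dotp q p.
Proof. by apply: eq_bigr => i _; rewrite mulrC. Qed.

Lemma dotpDl (R : realType) (p q r : 'cV[R]_2) :
  dotp (p + q) r = dotp p r + dotp q r.
Proof. by rewrite -big_split; apply: eq_bigr => i _; rewrite mxE mulrDl. Qed.

Lemma dotpZl (R : realType) (c : R) (p q : 'cV[R]_2) :
  dotp (c *: p) q = c * dotp p q.
Proof. by rewrite mulr_sumr; apply: eq_bigr => i _; rewrite mxE mulrA. Qed.

Lemma dotp_continuous (R : realType) (d : 'cV[R]_2) :
  continuous (fun p => dotp p d).
Proof.
have -> : (fun p => dotp p d) = fun p => p 0 0 * d 0 0 + p 1 0 * d 1 0.
  by apply/funext => p; rewrite dotpE.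
have c (i : 'I_2) (k : R) : continuous (fun p : 'cV[R]_2 => p i 0 * k).
  move=> p; apply: continuousM; [exact: coord_continuous | exact: cst_continuous].
by move=> p; exact: (continuousD (c 0 (d 0 0) p) (c 1 (d 1 0) p)).
Qed.

(** * Compactness in the plane *)

Lemma norm_trmx_le (R : realType) m n (p : 'M[R]_(m, n)) : `|p^T| <= `|p|.
Proof.
rewrite [leLHS]/Num.norm /= [leRHS]/Num.norm /= !mx_normrE.
apply: bigmax_le => [|[i j] _ /=]; first exact: bigmax_ge_id.
rewrite mxE; exact: (le_bigmax _ (fun ij => `|p ij.1 ij.2|) (j, i)).
Qed.

Lemma trmx_continuous (R : realType) m n :
  continuous (trmx : 'M[R]_(m, n) -> 'M[R]_(n, m)).
Proof.
move=> p; have Fp := nbhs_filter (p : 'M[R]_(m, n)).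
apply/(@cvgrPdist_lt R 'M[R]_(n, m) _ _ Fp) => e e0.
have := @cvgr_dist_lt R 'M[R]_(m, n) _ _ Fp id p cvg_id e e0.
apply: filterS => q; apply: le_lt_trans.
by rewrite -linearB norm_trmx_le.
Qed.

(** [bounded_closed_compact] concerns row vectors, whereas points here are columns. Transposition is
    continuous and does not increase the norm, so it carries compactness over. *)
Lemma bounded_closed_compact_cV (R : realType) n (A : set 'cV[R]_n) :
  bounded_set A -> closed A -> compact A.
Proof.
move=> [M [Mr bA]] cA.
have -> : A = trmx @` (trmx @^-1` A).
  rewrite eqEsubset; split=> [p Ap|_ [p /= Ap <-//]].
  by exists p^T; rewrite /= trmxK.
apply: continuous_compact; first exact/continuous_subspaceT/trmx_continuous.
apply: bounded_closed_compact.
  exists M; split=> // x Mx p /= /(bA _ Mx); apply: le_trans.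
  by rewrite -[in leLHS](trmxK p) norm_trmx_le.
by apply: closed_comp cA => p _; exact: trmx_continuous.
Qed.

(** * Derivatives along lines *)

Section directional_derivatives.
Context {R : realType}.
Implicit Types (f : 'cV[R]_2 -> R) (d p : 'cV[R]_2).

Lemma smooth_differentiable f p : smooth f -> differentiable f p.
Proof. by move=> /(_ [::]). Qed.

Lemma smooth_partial i f : smooth f -> smooth (partial i f).
Proof. by move=> sf s p; have := sf (rcons s i) p; rewrite foldr_rcons. Qed.

Lemma smooth_continuous f : smooth f -> continuous f.
Proof.
by move=> sf p; exact/differentiable_continuous/smooth_differentiable.
Qed.

Lemma derive_dotp f d p : differentiable f p -> 'D_d f p = dotp (grad f p) d.
Proof.
move=> df; rewrite deriveE//.
rewrite [X in 'd f p X = _](_ : d = \sum_i d i 0 *: delta_mx i 0); last first.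
  by apply/colP => i; rewrite summxE (bigD1 i)//= big1 ?addr0 ?mxE ?eqxx ?mulr1//
    => j ji; rewrite !mxE eq_sym (negbTE ji) mulr0.
rewrite linear_sum; apply: eq_bigr => i _.
by rewrite linearZ /= mxE /partial deriveE// mulrC.
Qed.

Lemma is_derive_line f p d (t : R) : differentiable f (p + t *: d) ->
  is_derive t 1 (fun s => f (p + s *: d)) ('D_d f (p + t *: d)).
Proof.
move=> df; have fd : derivable f (p + t *: d) d by exact: diff_derivable.
have E : (fun h : R => h^-1 *: (((fun s => f (p + s *: d)) \o shift t) (h *: 1)
       - f (p + t *: d))) =
    (fun h : R => h^-1 *: ((f \o shift (p + t *: d)) (h *: d) - f (p + t *: d))).
  apply/funext => h; congr (_ *: (f _ - _)); rewrite /= [_ *: 1]mulr1 scalerDl.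
  by rewrite addrCA.
by apply: DeriveDef; rewrite /derivable /derive E.
Qed.

Lemma line_continuous p d : continuous (fun t : R => p + t *: d).
Proof.
move=> t; apply: cvgD; first exact: cvg_cst.
by apply: cvgZr_tmp; exact: cvg_id.
Qed.

(** The endpoints are left unordered because increments of either sign occur, both in the abscissa
    and in the height of the ridge. *)
Lemma MVT_line f p d (a b : R) : (forall q, differentiable f q) ->
  exists2 c, Num.min a b <= c <= Num.max a b &
    f (p + b *: d) - f (p + a *: d) = (b - a) * 'D_d f (p + c *: d).
Proof.
move=> df.
wlog ab : a b / a <= b => [H|].
  have [|ba] := orP (le_total a b); first exact: H.
  have [c cab E] := H _ _ ba; exists c; first by rewrite minC maxC.
  by rewrite -opprB E -mulNr opprB.
have [] := @MVT_segment R (fun s => f (p + s *: d))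
    (fun s => 'D_d f (p + s *: d)) a b ab.
- by move=> x _; exact: is_derive_line.
- apply: continuous_subspaceT => t.
  apply: (@continuous_comp _ _ _ (fun t : R => p + t *: d) f).
    exact: line_continuous.
  exact: differentiable_continuous.
- move=> c cab E; exists c; last by rewrite E mulrC.
  by rewrite min_l// max_r//; move: cab; rewrite in_itv.
Qed.

End directional_derivatives.

(** * Functions of one variable *)

Section one_variable.
Context {R : realType}.

(** At the maximum [dh 0 = 0]. If [c] were positive, [dh] would be positive just to the right of
    [0], and by the mean value theorem [h] would rise above [h 0] there. *)
Lemma second_derivative_le0 (h dh : R -> R) (c : R) :
  (\forall t \near (0 : R), is_derive (t : R) 1 h (dh t)) ->
  is_derive (0 : R) 1 dh c ->
  (\forall t \near (0 : R), h t <= h 0) -> c <= 0.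
Proof.
move=> hd dhd hmax.
have [r /= r0 Hr] : exists2 r : R, 0 < r & forall t : R, `|t| < r ->
    is_derive t 1 h (dh t) /\ h t <= h 0.
  have : \forall t \near (0 : R), is_derive (t : R) 1 h (dh t) /\ h t <= h 0.
    by near=> t; split; near: t.
  move=> /nbhs_ballP[r /= r0 Hr]; exists r => // t tr; apply: Hr.
  by rewrite /ball/= sub0r normrN.
have dh0 : dh 0 = 0.
  have [h0 _] := Hr 0 ltac:(by rewrite normr0).
  rewrite -(@derive_val _ _ _ _ _ _ _ h0).
  apply: (@derive_val _ _ _ _ _ _ _ (@derive1_at_max _ h (- r) r 0 _ _ _ _)).
  - by rewrite -subr_ge0 opprK addr_ge0// ltW.
  - by move=> t; rewrite in_itv/= -ltr_norml => /Hr[[]].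
  - by rewrite in_itv/= oppr_lt0 r0.
  - by move=> t; rewrite in_itv/= -ltr_norml => /Hr[].
rewrite leNgt; apply/negP => c0.
have /cvgrPdist_lt/(_ c c0) :
    (fun s : R => s^-1 *: (dh (s *: 1 + 0) - dh 0)) @ 0^' --> c.
  by case: dhd => H1 <-; exact: H1.
move=> /nbhs_ballP[s /= s0 Hs].
pose m := Num.min r s.
have m0 : 0 < m by rewrite lt_min r0.
have dhpos t : 0 < t -> t < m -> 0 < dh t.
  move=> t0 tm; have := Hs t; rewrite /= /ball/= sub0r normrN gtr0_norm//.
  rewrite dh0 subr0 addr0 [_ *: 1]mulr1 (lt_le_trans tm) ?ge_min ?lexx ?orbT//.
  move=> /(_ isT (lt0r_neq0 t0)); rewrite ltr_norml => /andP[_].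
  rewrite ltrBlDr ltrDl => /=; by rewrite pmulr_rgt0 ?invr_gt0.
have m2 : 0 < m / 2 by rewrite divr_gt0.
have mm : m / 2 < m by rewrite ltr_pdivrMr// mulr_natr mulr2n ltrDl.
have mr : m <= r by rewrite ge_min lexx.
have [] := @MVT R h dh 0 (m / 2) m2.
- move=> x; rewrite in_itv/= => /andP[x0 xm]; apply: (Hr x _).1.
  by rewrite gtr0_norm// (lt_le_trans _ mr)// (lt_trans xm).
- apply: continuous_in_subspaceT => x; rewrite inE/= in_itv/= => /andP[x0 xm].
  apply: differentiable_continuous; apply/derivable1_diffP.
  apply: (@ex_derive _ _ _ _ _ _ _ (Hr x _).1).
  by rewrite ger0_norm// (lt_le_trans _ mr)// (le_lt_trans xm).
move=> x; rewrite in_itv/= => /andP[x0 xm] E.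
have : h (m / 2) <= h 0.
  by apply: (Hr (m/2) _).2; rewrite gtr0_norm// (lt_le_trans _ mr).
rewrite -subr_le0 E leNgt => /negP; apply.
by rewrite mulr_gt0 ?subr_gt0// dhpos// (lt_trans xm).
Unshelve. all: by end_near. Qed.

(* McShane's extension, [x |-> inf_(t in A) (f t + k * `|x - t|)]. *)
Lemma lipschitz_extension (k : R) (A : set R) (f : R -> R) :
  A !=set0 -> 0 <= k -> k.-lipschitz_A f ->
  exists g : R -> R, continuous g /\ {in A, g =1 f}.
Proof.
move=> [a0 Aa0] k0 fl.
have fl' x y : A x -> A y -> `|f x - f y| <= k * `|x - y|.
  by move=> Ax Ay; exact: (fl (x, y)).
pose S x := [set f t + k * `|x - t| | t in A].
have S0 x : S x !=set0 by exists (f a0 + k * `|x - a0|), a0.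
have step (x x' t : R) : k * `|x - t| <= k * `|x' - t| + k * `|x - x'|.
  by rewrite -mulrDr ler_wpM2l// [leRHS]addrC ler_distD.
have lbS x : lbound (S x) (f a0 - k * `|x - a0|).
  move=> _ [t At <-].
  have := fl' _ _ Aa0 At; have := step a0 x t.
  rewrite (distrC a0 x) ler_norml => ? /andP[_ ?]; lra.
have hS x : has_inf (S x) by split=> //; exists (f a0 - k * `|x - a0|).
have gl x y : inf (S x) <= inf (S y) + k * `|x - y|.
  rewrite -lerBlDr; apply: lb_le_inf => // _ [t At <-]; rewrite lerBlDr.
  apply: (@le_trans _ _ (f t + k * `|x - t|)).
    by apply: ge_inf; [case: (hS x) | exists t].
  by rewrite -addrA lerD2l.
exists (fun x => inf (S x)); split.
  (* The constant [k] may be [0], so the radius of continuity is taken as [e / (k + 1)]. *)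
  have k1 : 0 < k + 1 by rewrite ltr_wpDl.
  move=> x; apply/cvgrPdist_le => e e0.
  apply: filterS (nbhsx_ballx x _ (divr_gt0 e0 k1)) => y.
  rewrite -ball_normE /= => /ltW; rewrite ler_pdivlMr// mulrC mulrDl mul1r => xy.
  have := gl x y; have := gl y x; rewrite distrC => ? ?.
  by have := normr_ge0 (x - y); rewrite ler_norml => ?; apply/andP; split; lra.
move=> x /set_mem Ax; apply/eqP; rewrite eq_le; apply/andP; split.
  by apply: ge_inf; [case: (hS x) | exists x => //; rewrite subrr normr0 mulr0 addr0].
apply: lb_le_inf => // _ [t At <-].
by have := fl' _ _ Ax At; rewrite ler_norml => /andP[_]; rewrite lerBlDl addrC.
Qed.

End one_variable.

(** * The rotated frame and second-order calculus in the plane *)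

Section plane.
Context {R : realType}.
Implicit Types (f g : 'cV[R]_2 -> R) (d e p q : 'cV[R]_2).

Lemma rotJ0 e : (rotJ R *m e) 0 0 = - e 1 0.
Proof.
have i1 : lift ord0 ord0 = 1 :> 'I_2 by apply: val_inj.
by rewrite mxE !big_ord_recl big_ord0 i1 !mxE /=; ring.
Qed.

Lemma rotJ1 e : (rotJ R *m e) 1 0 = e 0 0.
Proof.
have i1 : lift ord0 ord0 = 1 :> 'I_2 by apply: val_inj.
by rewrite mxE !big_ord_recl big_ord0 i1 !mxE /=; ring.
Qed.

Lemma frameD e x h t : frame e (x + h) t = frame e x t + h *: e.
Proof. by rewrite /frame scalerDl addrAC. Qed.

Lemma frame_dotl e x t : dotp e e = 1 -> dotp (frame e x t) e = x.
Proof.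
move=> ee; rewrite /frame dotpDl !dotpZl ee (dotpE (_ *m _)) rotJ0 rotJ1.
by ring.
Qed.

Lemma frame_dotr e x t : dotp e e = 1 -> dotp (frame e x t) (rotJ R *m e) = t.
Proof.
move=> ee; rewrite /frame dotpDl !dotpZl !(dotpE _ (_ *m _)) rotJ0 rotJ1.
rewrite -[RHS]mulr1 -ee dotpE; ring.
Qed.

Lemma frameK e p : dotp e e = 1 ->
  frame e (dotp p e) (dotp p (rotJ R *m e)) = p.
Proof.
rewrite !dotpE rotJ0 rotJ1 => ee; apply/colP => i.
have [->|->] : i = 0 \/ i = 1.
  by case: i => [[|[|//]] H]; [left|right]; apply: val_inj.
- rewrite mxE [X in X + _]mxE [X in _ + X]mxE rotJ0 -[RHS]mulr1 -ee; ring.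
- rewrite mxE [X in X + _]mxE [X in _ + X]mxE rotJ1 -[RHS]mulr1 -ee; ring.
Qed.

(** The second derivative test is applied on each coordinate line through [p] and the results are
    summed; the term in [s] is affine and drops out. With [al = -1], [k = 0] this excludes interior
    minima of the torsion function, and with [al = 1] it serves the comparison with a parabola. *)
Lemma laplacian_le_local_max g p d (al k s c : R) : smooth g ->
  (\forall q \near p,
    al * g q + k / 2 * (dotp q d - c) ^+ 2 - s * (dotp q d - c) <=
    al * g p + k / 2 * (dotp p d - c) ^+ 2 - s * (dotp p d - c)) ->
  al * laplacian g p + k * dotp d d <= 0.
Proof.
move=> sg hmax; rewrite /laplacian /mxtrace /dotp !mulr_sumr -big_split /=.
apply: sumr_le0 => i _; rewrite mxE.
pose D : 'cV[R]_2 := delta_mx i 0.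
have dD t : dotp (p + t *: D) d = t * d i 0 + dotp p d.
  rewrite dotpDl dotpZl addrC /dotp (bigD1 i)//= !mxE !eqxx mul1r big1 ?addr0//.
  by move=> j ji; rewrite !mxE (negbTE ji) mul0r.
pose h (t : R) := al * g (p + t *: D) + k / 2 * (t * d i 0 + (dotp p d - c)) ^+ 2
    - s * (t * d i 0 + (dotp p d - c)).
pose dh (t : R) := al * partial i g (p + t *: D) +
   k * (t * d i 0 + (dotp p d - c)) * d i 0 - s * d i 0.
have L (f : 'cV[R]_2 -> R) (t : R) : differentiable f (p + t *: D) ->
  is_derive t 1 (fun s => f (p + s *: D)) (partial i f (p + t *: D)).
  exact: is_derive_line.
have scaleE (a b : R) : a *: b = a * b by [].
apply: (@second_derivative_le0 R h dh).
- near=> t; rewrite /h /dh.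
  have ? := L g t (smooth_differentiable _ sg).
  by apply: is_derive_eq; rewrite !scaleE; field.
- rewrite /dh.
  have := L (partial i g) 0 (smooth_differentiable _ (smooth_partial i sg)).
  rewrite scale0r addr0 => ?.
  by apply: is_derive_eq; rewrite !scaleE; ring.
- have cl : (fun t : R => p + t *: D) @ (0 : R) --> p.
    by have := @line_continuous R p D 0; rewrite /continuous_at scale0r addr0.
  apply: (@filterS _ _ (nbhs_filter (0 : R)) _ _ _ (cl _ hmax)) => t /=.
  by rewrite /h scale0r addr0 mul0r add0r dD addrA.
Unshelve. all: by end_near. Qed.

(** The estimate is uniform in the base point [q], as is required on horizontal segments whose
    height moves with the ridge. It follows from the mean value theorem and the continuity of the
    derivative at [p]. *)
Lemma strict_derive f d p (eps : R) : (forall q, differentiable f q) ->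
  continuous ('D_d f) -> 0 < eps ->
  exists2 del : R, 0 < del & forall q (t : R), ball p del q -> `|t| < del ->
    `|f (q + t *: d) - f q - t * 'D_d f p| <= eps * `|t|.
Proof.
move=> df cD e0.
have /(@cvgrPdist_le R R^o _ _ (nbhs_filter p))/(_ _ e0) := cD p.
move=> /nbhs_ballP[r /= r0 Hr].
have d1 : 0 < `|d| + 1 by rewrite ltr_wpDl.
have d2 : 0 < `|d| + 2 by rewrite ltr_wpDl.
(* A point within this radius of [p], moved along [d] by a parameter below the same radius, stays
   within [r] of [p]. *)
exists (r / (`|d| + 2)) => [|q t pq td]; first by rewrite divr_gt0.
have [c ct] := MVT_line q d 0 t df.
rewrite scale0r addr0 subr0 => ->.
rewrite -mulrBr normrM mulrC ler_wpM2r// distrC; apply: Hr.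
move: pq; rewrite -!ball_normE /= => pq.
have {ct}ct : `|c| <= `|t|.
  move: ct; case/orP: (le_total 0 t) => t0.
    by rewrite min_l// max_r// => /andP[c0 ct]; rewrite !ger0_norm.
  by rewrite min_r// max_l// => /andP[c0 ct]; rewrite !ler0_norm// lerN2.
have -> : r = r / (`|d| + 2) + r / (`|d| + 2) * (`|d| + 1).
  by field; rewrite gt_eqF.
rewrite opprD addrA (le_lt_trans (ler_normB _ _))// ltr_leD// normrZ.
apply: ler_pM => //; last by rewrite lerDl.
by rewrite (le_trans ct)// ltW.
Qed.

Lemma is_derive_dist (h : R -> R) (x l : R) :
  (forall eps : R, 0 < eps -> \forall t \near x,
     `|h t - h x - (t - x) * l| <= eps * `|t - x|) -> is_derive x 1 h l.
Proof.
move=> H.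
suff C : (fun s : R => s^-1 *: (h (s *: 1 + x) - h x)) @ 0^' --> l.
  by split; [exact: cvgP C | exact: cvg_lim C].
apply/cvgrPdist_le => eps e0.
have /nbhs_ballP[r /= r0 Hr] := H _ e0.
exists r => //= s; rewrite /ball /= sub0r normrN => sr s0.
have := Hr (s + x); rewrite /ball/= opprD addrCA subrr addr0 normrN => /(_ sr).
rewrite addrK [s *: 1]mulr1 distrC => Hs.
have sN : 0 < `|s| by rewrite normr_gt0.
rewrite -(ler_pM2r sN) -normrM mulrBl [s^-1 *: _]mulrC mulfVK//.
by rewrite (mulrC l).
Qed.

Lemma frame_near e x t (Q : set 'cV[R]_2) : nbhs (frame e x t) Q ->
  exists2 del : R, 0 < del &
    forall x' t' : R, `|x' - x| < del -> `|t' - t| < del ->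
    Q (frame e x' t').
Proof.
move=> /nbhs_ballP[r /= r0 Hr].
set f := rotJ R *m e.
have k0 : 0 < `|e| + `|f| + 1 by rewrite ltr_wpDl// addr_ge0.
exists (r / (`|e| + `|f| + 1)) => [|x' t' xx tt]; first by rewrite divr_gt0.
apply: Hr; rewrite -ball_normE /= /frame -/f.
have -> : x *: e + t *: f - (x' *: e + t' *: f) = (x - x') *: e + (t - t') *: f.
  by rewrite !scalerBl opprD addrACA.
rewrite (le_lt_trans (ler_normD _ _))// !normrZ (distrC x) (distrC t).
have := ler_wpM2r (normr_ge0 e) (ltW xx).
have := ler_wpM2r (normr_ge0 f) (ltW tt).
set r' := r / _ => H1 H2; apply: (le_lt_trans (lerD H2 H1)).
by rewrite -mulrDr /r' mulrAC ltr_pdivrMr// ltr_pM2l// ltrDl.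
Qed.

(** [smooth] speaks of iterated coordinate partials only. Their linearity makes the derivatives in
    the rotated directions smooth as well. *)
Lemma foldr_partial_lincomb (f g : 'cV[R]_2 -> R) (c k : R) (s : seq 'I_2) :
  smooth f -> smooth g ->
  foldr (@partial R) (c *: f + k *: g) s =
  c *: foldr (@partial R) f s + k *: foldr (@partial R) g s.
Proof.
move=> sf sg; elim: s => //= i s ->; apply/funext => p.
have ? : derivable (foldr (@partial R) f s) p (delta_mx i 0).
  exact/diff_derivable/sf.
have ? : derivable (foldr (@partial R) g s) p (delta_mx i 0).
  exact/diff_derivable/sg.
by rewrite /partial deriveD; [rewrite !deriveZ|exact: derivableZ|exact: derivableZ].
Qed.

Lemma smooth_derive d f : smooth f -> smooth ('D_d f).
Proof.
move=> sf; have -> : 'D_d f = d 0 0 *: partial 0 f + d 1 0 *: partial 1 f.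
  apply/funext => p; rewrite derive_dotp; last exact: smooth_differentiable.
  by rewrite dotpE !mxE mulrC (mulrC (partial 1 _ _)).
move=> s p; rewrite foldr_partial_lincomb; [|exact: smooth_partial..].
by apply: differentiableD; apply: differentiableZ; exact: smooth_partial.
Qed.

End plane.

(** * The torsion function *)

(** Conjugation by [rotJ R] exchanges the diagonal entries of the Hessian and changes the sign of
    the other two, so the stress equation yields the Hessian entry by entry. Contracting with [e]
    and [J e] gives the two identities. *)
Lemma airy_derive2 (R : realType) (g psi : 'cV[R]_2 -> R) (p e : 'cV[R]_2) :
  smooth g -> smooth psi -> dotp e e = 1 ->
  stress g p = (rotJ R)^T *m hess psi p *m rotJ R ->
  let f := rotJ R *m e in
  'D_e ('D_e psi) p = ('D_e g p) ^+ 2 - ('D_f g p) ^+ 2 - 2 * g p /\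
  'D_f ('D_e psi) p = 2 * 'D_e g p * 'D_f g p.
Proof.
move=> sg sp ee S f.
have i1 : lift ord0 ord0 = 1 :> 'I_2 by apply: val_inj.
have E i j : stress g p i j = ((rotJ R)^T *m hess psi p *m rotJ R) i j by rewrite S.
have DD d : 'D_d ('D_e psi) p =
    d 0 0 * (e 0 0 * hess psi p 0 0 + e 1 0 * hess psi p 0 1) +
    d 1 0 * (e 0 0 * hess psi p 1 0 + e 1 0 * hess psi p 1 1).
  have De : 'D_e psi = e 0 0 *: partial 0 psi + e 1 0 *: partial 1 psi.
    apply/funext => q; rewrite derive_dotp; last exact: smooth_differentiable.
    by rewrite dotpE !mxE mulrC (mulrC (partial 1 _ _)).
  have ds i j : derivable (partial i psi) p (delta_mx j 0).
    exact/diff_derivable/smooth_differentiable/smooth_partial.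
  have Dp i : partial i ('D_e psi) p =
      e 0 0 * hess psi p i 0 + e 1 0 * hess psi p i 1.
    rewrite De {1}/partial deriveD; [|exact: derivableZ|exact: derivableZ].
    by rewrite !deriveZ ?mxE.
  rewrite derive_dotp; last exact/smooth_differentiable/smooth_derive.
  by rewrite dotpE 2!mxE !Dp mulrC (mulrC (_ + _)).
have Dg d : 'D_d g p = grad g p 0 0 * d 0 0 + grad g p 1 0 * d 1 0.
  by rewrite derive_dotp ?dotpE//; exact: smooth_differentiable.
have := ee; rewrite !DD !Dg dotpE /f rotJ0 rotJ1 => {}ee.
have := E 0 0; have := E 0 1; have := E 1 0; have := E 1 1.
rewrite /stress !mxE !big_ord_recl !big_ord0 i1 !mxE.
rewrite !big_ord_recl !big_ord0 i1 !mxE /= dotpE !mxE.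
rewrite (_ : ord0 = 0)//.
set H00 := partial 0 (partial 0 psi) p; set H01 := partial 0 (partial 1 psi) p.
set H10 := partial 1 (partial 0 psi) p; set H11 := partial 1 (partial 1 psi) p.
set u0 := partial 0 g p; set u1 := partial 1 g p => e11 e10 e01 e00.
have -> : H00 = u0 ^+ 2 - u1 ^+ 2 - 2 * g p by lra.
have -> : H11 = u1 ^+ 2 - u0 ^+ 2 - 2 * g p by lra.
have -> : H10 = 2 * u0 * u1 by lra.
have -> : H01 = 2 * u0 * u1 by lra.
split; last by ring.
(* The term [2 * g p] is the only one not quadratic in [e]; the factor [dotp e e = 1] makes the
   identity homogeneous. *)
by rewrite -[2 * g p in RHS]mulr1 -[X in 2 * g p * X]ee; ring.
Qed.

Section torsion.
Context {R : realType}.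
Variables (A : set 'cV[R]_2) (g : 'cV[R]_2 -> R).
Hypotheses (oA : open A) (bA : bounded_set A) (sg : smooth g).
Hypothesis lapg : forall p, A p -> laplacian g p = -1.
Hypothesis g0 : forall p, boundary A p -> g p = 0.

Lemma closure_boundary p : closure A p -> A p \/ boundary A p.
Proof.
move=> cp; have [|nA] := pselect (A p); [by left|right; split=> //].
by move/interior_subset.
Qed.

Lemma compact_closure : compact (closure A).
Proof.
apply: bounded_closed_compact_cV; last exact: closed_closure.
case: bA => M [Mr H]; exists M; split=> // x Mx p cp.
have : closure A `<=` [set q | `|q| <= x].
  rewrite closureE => q; apply; split; last by move=> r Ar; exact: H.
  exact: (closed_comp (fun _ _ => @norm_continuous _ _ _) (@closed_le _ x)).
exact.
Qed.

(** Minimum principle: an interior minimum would force a nonnegative Laplacian, against the value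
    [-1]. Hence the minimum over the closure lies on the boundary and equals [0], and a zero inside
    would again be an interior minimum. *)
Lemma torsion_gt0 p : A p -> 0 < g p.
Proof.
move=> Ap.
have nomin q : A q -> (forall r, A r -> g q <= g r) -> False.
  move=> Aq mq.
  suff : (-1 : R) * laplacian g q + 0 * dotp 0 0 <= 0 by rewrite lapg//; lra.
  apply: (@laplacian_le_local_max R g q 0 (-1) 0 0 0 sg); near=> r.
  rewrite !mul0r !addr0 !subr0 !mulN1r lerN2; apply: mq; near: r.
  exact: open_nbhs_nbhs.
have [c cA cmin] :
    exists2 c, c \in closure A & forall t, t \in closure A -> g c <= g t.
  apply: compact_EVT_min; [by exists p; exact: subset_closure|exact: compact_closure|].
  exact/continuous_subspaceT/smooth_continuous.
have cmin' r : A r -> g c <= g r by move=> Ar; apply/cmin/mem_set/subset_closure.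
have gc0 : g c = 0.
  by case: (closure_boundary (set_mem cA)) => [Ac|/g0//]; case: (nomin c Ac).
rewrite lt_neqAle -{2}gc0 cmin'// andbT; apply/eqP => gp0.
by apply: (nomin p Ap) => r Ar; rewrite -gp0 -gc0 cmin'.
Unshelve. all: by end_near. Qed.

(* For [s] slightly below ['D_e g p0] and [k > 1], let [W] be [g] minus the
   parabola [s t - k t^2 / 2], where [t] is the [e]-coordinate relative to [p0].
   [W] has Laplacian [k - 1 > 0] and exceeds [W p0] for small [t > 0], so its
   maximum over the strip [0 <= t <= s / k] can only be attained at the vertex
   [t = s / k], which [g <= M] excludes. *)
Lemma ridge_gradient_bound_pos (M : R) (e p0 : 'cV[R]_2) : dotp e e = 1 ->
  (forall p, A p -> g p <= M) -> A p0 ->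
  (forall q, A q -> dotp q e = dotp p0 e -> g q <= g p0) ->
  0 < 'D_e g p0 -> ('D_e g p0) ^+ 2 <= 2 * (M - g p0).
Proof.
move=> ee gM Ap0 line; set p := 'D_e g p0 => p_gt0.
set m := 2 * (M - g p0).
have m0 : 0 <= m by rewrite mulr_ge0// subr_ge0 gM.
rewrite leNgt; apply/negP => mp.
(* The square of [s] is the midpoint of [m] and [p ^+ 2], so that both [s < p] and [m < s ^+ 2] are
   strict. *)
pose s := Num.sqrt ((p ^+ 2 + m) / 2).
have s2 : s ^+ 2 = (p ^+ 2 + m) / 2.
  by rewrite sqr_sqrtr// divr_ge0// addr_ge0// sqr_ge0.
have s0 : 0 < s by rewrite sqrtr_gt0 divr_gt0// ltr_wpDr// exprn_gt0.
have sp : s < p by rewrite -(@ltr_pXn2r _ 2) ?nnegrE ?ltW// s2; lra.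
have ms : m < s ^+ 2 by rewrite s2; lra.
have m1 : 0 < 2 * (m + 1) by lra.
(* The excess over [1] is small enough to keep [k * m <= s ^+ 2], that is [m <= s * T]: the depth
   [s * T / 2] of the parabola at its vertex is at least [M - g p0]. *)
pose k := 1 + (s ^+ 2 - m) / (2 * (m + 1)).
have k1 : 1 < k by rewrite ltrDl divr_gt0// subr_gt0.
have k0 : 0 < k by lra.
have km : k * m <= s ^+ 2.
  rewrite /k mulrDl mul1r mulrAC -lerBrDl ler_pdivrMr//.
  rewrite ler_wpM2l ?subr_ge0 ?ltW//; lra.
pose T := s / k; have T0 : 0 < T by rewrite divr_gt0.
have kT : k * T = s by rewrite /T mulrC divfK// gt_eqF.
pose x0 := dotp p0 e.
pose W q := g q + k / 2 * (dotp q e - x0) ^+ 2 - s * (dotp q e - x0).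
have cc (a : R) (q : 'cV[R]_2) : {for q, continuous (fun _ : 'cV[R]_2 => a)}.
  exact: cst_continuous.
have cdot : continuous (fun q : 'cV[R]_2 => dotp q e - x0).
  by move=> q; exact: (continuousB (@dotp_continuous R e q) (cc x0 q)).
have cW : continuous W.
  move=> q.
  have c2 : {for q, continuous (fun q : 'cV[R]_2 => (dotp q e - x0) ^+ 2)}.
    exact: (continuousM (cdot q) (cdot q)).
  have c3 : {for q, continuous (fun q : 'cV[R]_2 => k / 2 * (dotp q e - x0) ^+ 2)}.
    exact: (continuousM (cc (k / 2) q) c2).
  have c4 : {for q, continuous (fun q : 'cV[R]_2 => s * (dotp q e - x0))}.
    exact: (continuousM (cc s q) (cdot q)).
  have c5 := continuousD (smooth_continuous sg (x := q)) c3.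
  exact: (continuousB c5 c4).
pose K := closure A `&` [set q | 0 <= dotp q e - x0 <= T].
have cK : compact K.
  apply: compact_closedI; first exact: compact_closure.
  have -> : [set q | 0 <= dotp q e - x0 <= T] =
      (fun q => dotp q e - x0) @^-1` `[0, T]%classic.
    by apply/seteqP; split=> q /=; rewrite in_itv.
  apply: closed_comp => [q _|]; first exact: cdot.
  exact: interval_closed.
have Kp0 : K p0 by split; [exact: subset_closure|rewrite /= subrr lexx ltW].
have [c /set_mem Kc cmax] : exists2 c, c \in K & forall t, t \in K -> W t <= W c.
  by apply: compact_EVT_max => //; [exists p0|exact/continuous_subspaceT].
(* Along [e] from [p0], the function [g] gains at least [(p + s) / 2 * t] for small [t > 0], while
   the parabola costs at most [s * t]. *)
have Wc : g p0 < W c.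
  have ps0 : 0 < (p - s) / 2 by lra.
  have [del d0 Hdel] := @strict_derive R g e p0 ((p - s) / 2)
    (fun q => smooth_differentiable q sg) (smooth_continuous (smooth_derive e sg)) ps0.
  have [r r0 Hr] :
      exists2 r : R, 0 < r & forall t : R, 0 < t < r -> A (p0 + t *: e).
    have := @line_continuous R p0 e 0; rewrite /continuous_at scale0r addr0.
    move=> /(_ A (open_nbhs_nbhs (conj oA Ap0)))/nbhs_ballP[r /= r0 Hr].
    exists r => // t /andP[t0 tr]; apply: Hr.
    by rewrite /ball/= sub0r normrN gtr0_norm.
  pose t := Num.min T (Num.min del r) / 2.
  have tm : 0 < Num.min T (Num.min del r) by rewrite !lt_min T0 d0 r0.
  have t0 : 0 < t by rewrite divr_gt0.
  have : t < Num.min T (Num.min del r) by rewrite /t; lra.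
  rewrite !lt_min => /and3P[tT td tr].
  have dt : dotp (p0 + t *: e) e - x0 = t.
    by rewrite dotpDl dotpZl ee /x0; ring.
  have Kt : K (p0 + t *: e).
    by split; [apply/subset_closure/Hr; rewrite t0|rewrite /= dt !ltW].
  apply: lt_le_trans (cmax _ (mem_set Kt)).
  rewrite /W dt.
  have := Hdel p0 t (ballxx _ d0); rewrite gtr0_norm// => /(_ td).
  rewrite -/p ler_norml => /andP[H _].
  have : 0 <= k / 2 * t ^+ 2 by rewrite mulr_ge0// ?sqr_ge0// divr_ge0// ltW.
  have : 0 < (p - s) * t by rewrite mulr_gt0// subr_gt0.
  by move: H; lra.
case: Kc => clc /=; set tau := dotp c e - x0 => /andP[tau0 tauT].
have g0p0 := torsion_gt0 Ap0.
(* Four places for the maximum point [c]. On the boundary [g] vanishes and the quadratic correction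
   is nonpositive on the strip, so [W c <= 0 < g p0]. The side through [p0], the vertex side and the
   interior of the strip follow in this order. *)
case: (closure_boundary clc) => [Ac|/g0 gc0]; last first.
  move: Wc; rewrite /W -/tau gc0.
  have : tau * (k * tau) <= tau * s by rewrite -kT !ler_wpM2l// ltW.
  have : 0 <= tau * s by rewrite mulr_ge0// ltW.
  by rewrite expr2; lra.
move: tau0; rewrite le_eqVlt => /predU1P[tau0|tau0].
  move: Wc; rewrite /W -/tau -tau0 expr0n /= !mulr0 addr0 subr0 ltNge line//.
  by apply/eqP; rewrite -subr_eq0 -/x0 -/tau -tau0.
move: tauT; rewrite le_eqVlt => /predU1P[tauT|tauT].
  move: Wc; rewrite /W -/tau tauT.
  have := gM c Ac.
  have : m <= s * T by rewrite /T mulrA -expr2 ler_pdivlMr// mulrC.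
  have : k / 2 * T ^+ 2 = s * T / 2 by rewrite -kT; field.
  by rewrite /m; lra.
suff : (1 : R) * laplacian g c + k * dotp e e <= 0 by rewrite lapg// ee; lra.
apply: (@laplacian_le_local_max R g c e 1 k s x0) => //.
have nK : \forall q \near c, K q.
  have nA : \forall q \near c, A q by exact: open_nbhs_nbhs.
  have nb : nbhs (dotp c e - x0) `]0, T[%classic.
    apply: open_nbhs_nbhs; split; first exact: interval_open.
    by rewrite /= in_itv/= tau0.
  have nT : \forall q \near c, 0 < dotp q e - x0 < T.
    apply: (@filterS _ _ (nbhs_filter c) _ _ _ (cdot c _ nb)) => q.
    by rewrite /= in_itv.
  apply: filterS2 nA nT => q Aq /andP[? ?].
  by split; [exact: subset_closure|rewrite /= !ltW].
by apply: filterS nK => q Kq; rewrite !mul1r; exact/cmax/mem_set.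
Qed.

Lemma ridge_gradient_bound (M : R) (e p0 : 'cV[R]_2) : dotp e e = 1 ->
  (forall p, A p -> g p <= M) -> A p0 ->
  (forall q, A q -> dotp q e = dotp p0 e -> g q <= g p0) ->
  ('D_e g p0) ^+ 2 <= 2 * (M - g p0).
Proof.
move=> ee gM Ap0 line.
have N q : dotp q (- e) = - dotp q e by rewrite dotpC -scaleN1r dotpZl dotpC mulN1r.
have DN : 'D_(- e) g p0 = - 'D_e g p0.
  by rewrite !derive_dotp ?N//; exact: smooth_differentiable.
have [p_gt0|p_lt0|<-] := ltgtP 0 ('D_e g p0).
- exact: ridge_gradient_bound_pos.
- rewrite -sqrrN -DN; apply: ridge_gradient_bound_pos => //.
  + by rewrite N dotpC N opprK.
  + by move=> q Aq; rewrite !N => /oppr_inj; exact: line.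
  + by rewrite DN oppr_gt0.
- by rewrite expr0n mulr_ge0// subr_ge0 gM.
Qed.

End torsion.

(** * The ridge *)

Section ridge.
Context {R : realType}.
Variables (A : set 'cV[R]_2) (g : 'cV[R]_2 -> R) (e : 'cV[R]_2).
Variables (a b : R) (y : R -> R).
Hypotheses (oA : open A) (bA : bounded_set A) (sg : smooth g).
Hypothesis lapg : forall p, A p -> laplacian g p = -1.
Hypothesis g0 : forall p, boundary A p -> g p = 0.
Hypothesis ee : dotp e e = 1.
Hypothesis Ay : forall x, x \in `]a, b[ -> A (frame e x (y x)).
Hypothesis ymax : forall x t, x \in `]a, b[ -> A (frame e x t) ->
  g (frame e x t) <= g (frame e x (y x)).
Hypothesis yuniq : forall x t, x \in `]a, b[ -> A (frame e x t) ->
  g (frame e x t) = g (frame e x (y x)) -> t = y x.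

Local Notation f := (rotJ R *m e).
Local Notation P := (fun x => frame e x (y x)).

Lemma near_frame_in x t : A (frame e x t) ->
  exists2 del : R, 0 < del &
    forall x' t' : R, `|x' - x| < del -> `|t' - t| < del ->
    A (frame e x' t').
Proof. by move=> Ap; apply: frame_near; exact: open_nbhs_nbhs. Qed.

(** Let [C] be the compact set of points of the closure that lie at height at least [eps] away from
    [y x] and where [g] is no smaller than at height [y x] over the same abscissa. Its projection is
    closed and misses [x], by uniqueness of the maximizer inside and by positivity of the maximum
    against boundary points. For [t] near [x], a ridge point at distance [eps] or more in height
    would put [t] in this projection. *)
Lemma ridge_continuous x : x \in `]a, b[ -> {for x, continuous y}.
Proof.
move=> xab; apply/cvgrPdist_lt => eps e0.
pose dx (p : 'cV[R]_2) := dotp p e; pose dy (p : 'cV[R]_2) := dotp p f.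
have cx : continuous dx by exact: dotp_continuous.
have cy : continuous dy by exact: dotp_continuous.
pose far (p : 'cV[R]_2) := `|y x - dy p|.
pose gap (p : 'cV[R]_2) := g p - g (frame e (dx p) (y x)).
have cfar : continuous far.
  move=> p; apply: (@continuous_comp _ _ _ dy (fun t => `|y x - t|)); first exact: cy.
  move=> t /=; apply: (@continuous_comp _ _ _ (fun s => y x - s) Num.norm).
    by apply: continuousB; [exact: cvg_cst|exact: cvg_id].
  exact: norm_continuous.
have cgap : continuous gap.
  move=> p; have := smooth_continuous sg (x := p).
  have cf : {for dx p, continuous (fun s => g (frame e s (y x)))}.
    apply: (@continuous_comp _ _ _ (fun s => frame e s (y x)) g); last first.
      exact: smooth_continuous.
    apply: continuousD; last exact: cst_continuous.
    by have := @line_continuous R 0 e (dx p); under eq_fun do rewrite add0r.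
  move=> c1; have c2 := continuous_comp (cx p) cf.
  exact: (continuousB c1 c2).
pose C := closure A `&` ([set p | eps <= far p] `&` [set p | 0 <= gap p]).
have cC : compact C.
  apply: compact_closedI; first exact: compact_closure.
  apply: closedI.
    by apply: (@closed_comp _ _ far [set s | eps <= s]) => [p _|];
      [exact: cfar|exact: closed_ge].
  by apply: (@closed_comp _ _ gap [set s | 0 <= s]) => [p _|];
    [exact: cgap|exact: closed_ge].
have cdC : closed (dx @` C).
  apply: compact_closed; first exact: Rhausdorff.
  by apply: continuous_compact => //; exact: continuous_subspaceT.
have xC : ~ (dx @` C) x.
  move=> [p [cp [/= farp gapp]] xp].
  have pE : p = frame e x (dy p) by rewrite -{1}(frameK p ee) -/(dx p) xp.
  have gp : g (P x) <= g p by move: gapp; rewrite /gap xp subr_ge0.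
  have gx : 0 < g (P x) by apply: (torsion_gt0 oA bA sg lapg g0); exact: Ay.
  case: (closure_boundary cp) => [Ap|/g0 gp0]; last first.
    by move: gp; rewrite gp0 leNgt gx.
  move: Ap gp; rewrite pE => Ap gp.
  have yE : dy p = y x.
    by apply: yuniq => //; apply/eqP; rewrite eq_le ymax.
  by move: farp; rewrite /far yE subrr normr0 leNgt e0.
have nC : \forall t \near x, ~ (dx @` C) t.
  by apply: open_nbhs_nbhs; split => //; exact: closed_openC.
have [del d0 Hdel] := near_frame_in (Ay xab).
near=> t.
have tab : t \in `]a, b[ by near: t; exact: near_in_itvoo.
rewrite ltNge; apply/negP => far_t.
have : ~ (dx @` C) t by near: t.
apply; exists (P t); last by rewrite /dx frame_dotl.
split; first by apply/subset_closure/Ay.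
split; first by rewrite /= /far /dy frame_dotr.
rewrite /= /gap /dx frame_dotl// subr_ge0 ymax//; apply: Hdel.
  by rewrite distrC; near: t; apply: (@cvgr_dist_lt _ _ _ _ _ id x); [exact: cvg_id|].
by rewrite subrr normr0.
Unshelve. all: by end_near. Qed.

Lemma ridge_critical x : x \in `]a, b[ -> 'D_f g (P x) = 0.
Proof.
move=> xab; have [del d0 Hdel] := near_frame_in (Ay xab).
have L (t : R) :
    is_derive t 1 (fun s => g (x *: e + s *: f)) ('D_f g (x *: e + t *: f)).
  exact/is_derive_line/smooth_differentiable.
rewrite -(@derive_val _ _ _ _ _ _ _ (L (y x))).
apply: (@derive_val _ _ _ _ _ _ _
  (@derive1_at_max _ _ (y x - del) (y x + del) (y x) _ _ _ _)).
- by lra.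
- by move=> t _; exact: (@ex_derive _ _ _ _ _ _ _ (L t)).
- by rewrite in_itv/=; lra.
- move=> t; rewrite in_itv/= => /andP[t1 t2]; apply: ymax => //; apply: Hdel.
    by rewrite subrr normr0.
  by rewrite ltr_norml; lra.
Qed.

(* The increment of [v] is squeezed between the increments of [g] along the two
   horizontal segments at heights [y x] and [y t]. *)
Lemma is_derive_ridge_max x : x \in `]a, b[ ->
  is_derive x 1 (fun t => g (P t)) ('D_e g (P x)).
Proof.
move=> xab; apply: is_derive_dist => eps e0.
have [del d0 Hdel] := near_frame_in (Ay xab).
have [r r0 Hr] := @strict_derive R g e (P x) eps
  (fun q => smooth_differentiable q sg) (smooth_continuous (smooth_derive e sg)) e0.
have [r' r'0 Hr'] := frame_near (nbhsx_ballx (P x) r r0).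
pose m := Num.min del (Num.min r r').
have m0 : 0 < m by rewrite !lt_min d0 r0.
have /cvgrPdist_lt/(_ _ m0) ? := ridge_continuous xab.
near=> t.
have tab : t \in `]a, b[ by near: t; exact: near_in_itvoo.
have : `|t - x| < m.
  by near: t; have := nbhsx_ballx x m m0; rewrite -ball_normE /= /ball_;
    apply: filterS => t; rewrite /= distrC.
have : `|y t - y x| < m.
  by rewrite distrC; near: t.
rewrite !lt_min => /and3P[yd yr yr'] /and3P[td tr tr'].
have xx (z c : R) : 0 < c -> `|z - z| < c by rewrite subrr normr0.
have txE s : frame e t s = frame e x s + (t - x) *: e by rewrite -frameD addrC subrK.
have lo := Hr (frame e x (y x)) (t - x) (Hr' _ _ (xx _ _ r'0) (xx _ _ r'0)) tr.
have up := Hr (frame e x (y t)) (t - x) (Hr' _ _ (xx _ _ r'0) yr') tr.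
move: lo up; rewrite -!txE !ler_norml => /andP[lo _] /andP[_ up].
have m1 : g (frame e t (y x)) <= g (frame e t (y t)).
  by apply: ymax => //; apply: Hdel => //; rewrite subrr normr0.
have m2 : g (frame e x (y t)) <= g (frame e x (y x)).
  by apply: ymax => //; apply: Hdel => //; exact: xx.
by apply/andP; split; lra.
Unshelve. all: by end_near. Qed.

Variable psi : 'cV[R]_2 -> R.
Hypothesis spsi : smooth psi.
Hypothesis airy : forall p, A p -> stress g p = (rotJ R)^T *m hess psi p *m rotJ R.

(** The path from [P x] to [P t] goes vertically to height [y t] over [x], then horizontally. The
    horizontal part yields the derivative up to an error [eps / 2] times the increment, and the
    vertical part is itself an error of that size. *)
Lemma is_derive_ridge_airy x : x \in `]a, b[ ->
  is_derive x 1 (fun t => 'D_e psi (P t)) (('D_e g (P x)) ^+ 2 - 2 * g (P x)).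
Proof.
move=> xab.
have -> : ('D_e g (P x)) ^+ 2 - 2 * g (P x) = 'D_e ('D_e psi) (P x).
  have [-> _] := airy_derive2 sg spsi ee (airy (Ay xab)).
  by rewrite ridge_critical// expr0n subr0.
apply: is_derive_dist => eps e0.
have sPhi : smooth ('D_e psi) by exact: smooth_derive.
have sgf : smooth ('D_f g) by exact: smooth_derive.
have e2 : 0 < eps / 2 by rewrite divr_gt0.
have [del d0 Hdel] := near_frame_in (Ay xab).
have [r1 r10 Hr1] := @strict_derive R ('D_e psi) e (P x) (eps / 2)
  (fun q => smooth_differentiable q sPhi) (smooth_continuous (smooth_derive e sPhi)) e2.
have [r1' r1'0 Hr1'] := frame_near (nbhsx_ballx (P x) r1 r10).
(* Tolerance [1] suffices: it makes ['D_f g] vary at rate at most [L] along short horizontal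
   segments near [P x]. *)
have [r2 r20 Hr2] := @strict_derive R ('D_f g) e (P x) 1
  (fun q => smooth_differentiable q sgf) (smooth_continuous (smooth_derive e sgf)) ltr01.
have [r2' r2'0 Hr2'] := frame_near (nbhsx_ballx (P x) r2 r20).
pose G := `|'D_e g (P x)| + 1; pose L := `|'D_e ('D_f g) (P x)| + 1.
have nG : nbhs (P x) (fun q => `|'D_e g q| < G).
  have := smooth_continuous (smooth_derive e sg) (x := P x).
  move=> /(@cvgrPdist_lt R R^o _ _ (nbhs_filter (P x)))/(_ _ ltr01).
  apply: filterS => q H; rewrite /G -ltrBlDl; apply: le_lt_trans H.
  by rewrite distrC lerB_dist.
have [r3 r30 Hr3] := frame_near nG.
have G0 : 0 < G by rewrite ltr_wpDl.
have L0 : 0 < L by rewrite ltr_wpDl.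
(* The vertical increment is at most the height difference times [2 * G * L] times the distance from
   [t] to [x]; a height difference below [eta] makes this [eps / 2] times that distance. *)
pose eta := eps / (4 * G * L).
have eta0 : 0 < eta by rewrite divr_gt0// !mulr_gt0.
pose m := Num.min (Num.min (Num.min del r1) (Num.min r1' r2))
  (Num.min (Num.min r2' r3) eta).
have m0 : 0 < m by rewrite !lt_min d0 r10 r1'0 r20 r2'0 r30.
have /cvgrPdist_lt/(_ _ m0) ? := ridge_continuous xab.
near=> t.
have tab : t \in `]a, b[ by near: t; exact: near_in_itvoo.
have : `|t - x| < m.
  by near: t; have := nbhsx_ballx x m m0; rewrite -ball_normE /= /ball_;
    apply: filterS => t; rewrite /= distrC.
have : `|y t - y x| < m.
  by rewrite distrC; near: t.
rewrite !lt_min => /andP[/andP[/andP[yd _] /andP[yr1' _]]] /andP[/andP[yr2' yr3] yeta].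
move=> /andP[/andP[/andP[_ tr1] /andP[_ tr2]] _].
have xx (z c : R) : 0 < c -> `|z - z| < c by rewrite subrr normr0.
have shift s x' : frame e x' s = frame e x s + (x' - x) *: e.
  by rewrite -frameD addrC subrK.
have horizontal := Hr1 (frame e x (y t)) (t - x) (Hr1' _ _ (xx _ _ r1'0) yr1') tr1.
rewrite -shift in horizontal.
have [c yc vertical] := @MVT_line R ('D_e psi) (x *: e) f (y x) (y t)
  (fun q => smooth_differentiable q sPhi).
have {}yc_le : `|c - y x| <= `|y t - y x|.
  move: yc; case/orP: (le_total (y x) (y t)) => yy.
    rewrite min_l// max_r// => /andP[c1 c2].
    by rewrite !ger0_norm ?subr_ge0// lerD2r.
  rewrite min_r// max_l// => /andP[c1 c2].
  by rewrite !ler0_norm ?subr_le0// lerN2 lerD2r.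
(* The intermediate height [c] from the mean value theorem is the ridge height over some [x']
   between [x] and [t], by continuity of [y]. *)
have [x' x't yx'] : exists2 x', `|x' - x| <= `|t - x| /\ x' \in `]a, b[ & y x' = c.
  have sub l u : l \in `]a, b[ -> u \in `]a, b[ ->
      forall z, z \in `[l, u] -> z \in `]a, b[.
    move=> + + z; rewrite !in_itv/= => /andP[al _] /andP[_ ub] /andP[lz zu].
    by rewrite (lt_le_trans al)// (le_lt_trans zu).
  have cont l u : l \in `]a, b[ -> u \in `]a, b[ ->
      {within `[l, u], continuous y}.
    move=> lab uab; apply: continuous_in_subspaceT => z /set_mem zlu.
    exact/ridge_continuous/(sub _ _ lab uab).
  case/orP: (le_total x t) => xt.
    have [x' x'xt yx'] := IVT xt (cont _ _ xab tab) yc.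
    exists x' => //; split; last exact: (sub _ _ xab tab).
    move: x'xt; rewrite in_itv/= => /andP[? ?].
    by rewrite !ger0_norm ?subr_ge0// lerD2r.
  have yc' : Num.min (y t) (y x) <= c <= Num.max (y t) (y x) by rewrite minC maxC.
  have [x' x'xt yx'] := IVT xt (cont _ _ tab xab) yc'.
  exists x' => //; split; last exact: (sub _ _ tab xab).
  move: x'xt; rewrite in_itv/= => /andP[? ?].
  by rewrite !ler0_norm ?subr_le0// lerN2 lerD2r.
case: x't => x't x'ab.
(* ['D_f g] vanishes at the ridge point [P x'], which lies at the same height [c] as [frame e x c]
   and at horizontal distance at most that of [t] from [x]. *)
have Dg_c : `|'D_f g (frame e x c)| <= L * `|t - x|.
  have := Hr2 (frame e x c) (x' - x)
    (Hr2' _ _ (xx _ _ r2'0) (le_lt_trans yc_le yr2')) (le_lt_trans x't tr2).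
  rewrite -shift -yx' ridge_critical// yx' mul1r.
  set D := 'D_f g _; set D2 := 'D_e _ _ => H.
  have -> : D = - (0 - D - (x' - x) * D2) - (x' - x) * D2 by ring.
  rewrite (le_trans (ler_normB _ _))// normrN normrM.
  rewrite /L [leRHS]mulrDl mul1r [leRHS]addrC.
  apply: lerD; first exact: le_trans H x't.
  by rewrite mulrC ler_wpM2l.
have Ac : A (frame e x c).
  by apply: Hdel; [exact: xx|exact: le_lt_trans yd].
have [_ E] := airy_derive2 sg spsi ee (airy Ac).
rewrite -/(frame e x c) E in vertical.
rewrite -!/(frame e x _) in vertical.
have vert : `|'D_e psi (frame e x (y t)) - 'D_e psi (P x)| <= eps / 2 * `|t - x|.
  rewrite vertical 3!normrM normr_nat.
  have -> : eps / 2 * `|t - x| = eta * (2 * G * (L * `|t - x|)).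
    by rewrite /eta; field; rewrite !gt_eqF.
  apply: ler_pM => //; first exact: ltW.
  apply: ler_pM => //.
  rewrite ler_pM2l//; apply: ltW; apply: Hr3; first exact: xx.
  exact: le_lt_trans yr3.
have -> : 'D_e psi (P t) - 'D_e psi (P x) - (t - x) * 'D_e ('D_e psi) (P x) =
  ('D_e psi (P t) - 'D_e psi (frame e x (y t)) - (t - x) * 'D_e ('D_e psi) (P x))
  + ('D_e psi (frame e x (y t)) - 'D_e psi (P x)) by ring.
rewrite (le_trans (ler_normD _ _))// [eps]splitr [leRHS]mulrDl.
exact: lerD.
Unshelve. all: by end_near. Qed.

End ridge.

(** * Passage to smooth extensions, and the theorem *)

Lemma eq_on_open_partial (R : realType) (A : set 'cV[R]_2)
    (f g : 'cV[R]_2 -> R) (i : 'I_2) : open A -> (forall p, A p -> f p = g p) ->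
  forall p, A p -> partial i f p = partial i g p.
Proof.
move=> oA fg p Ap; apply: near_eq_derive.
by apply: filterS (open_nbhs_nbhs (conj oA Ap)) => q; exact: fg.
Qed.

Lemma eq_on_open_hess (R : realType) (A : set 'cV[R]_2)
    (f g : 'cV[R]_2 -> R) : open A -> (forall p, A p -> f p = g p) ->
  forall p, A p -> hess f p = hess g p.
Proof.
move=> oA fg p Ap; apply/matrixP => i j; rewrite !mxE.
by apply: (eq_on_open_partial i oA _ Ap) => q; exact: eq_on_open_partial.
Qed.

Lemma eq_on_open_grad (R : realType) (A : set 'cV[R]_2)
    (f g : 'cV[R]_2 -> R) : open A -> (forall p, A p -> f p = g p) ->
  forall p, A p -> grad f p = grad g p.
Proof.
by move=> oA fg p Ap; apply/colP => i; rewrite !mxE; exact: eq_on_open_partial Ap.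
Qed.

Theorem lemma4p2 (R : realType) (Omega : set 'cV[R]_2)
    (u phi : 'cV[R]_2 -> R) (M : R) (e : 'cV[R]_2) (a b : R) (v y : R -> R)
    (Omega_smooth : smooth_domain Omega)
    (Omega_bounded : bounded_set Omega)
    (Omega_convex : strictly_convex Omega)
    (u_torsion : torsion_function Omega u)
    (M_max : is_max (u @` Omega) M)
    (phi_airy : airy_potential Omega u phi)
    (e_unit : dotp e e = 1)
    (ab_proj : [set x | exists t, Omega (frame e x t)] = `]a, b[%classic)
    (v_max : forall x, x \in `]a, b[ ->
       is_max [set u (frame e x t) | t in [set t | Omega (frame e x t)]] (v x))
    (y_argmax : forall x, x \in `]a, b[ ->
       unique (fun t => Omega (frame e x t) /\ u (frame e x t) = v x) (y x)) :
  let X := fun p => - grad phi p in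
  let z := fun x : R => dotp (X (frame e x (y x))) e in
  [/\ [locally [lipschitz z x | x in `]a, b[%classic]],
      {ae @lebesgue_measure R, forall x, x \in `]a, b[ ->
         [/\ derivable v x 1, derivable z x 1 &
             derive1 z x = 2 * v x - (derive1 v x) ^+ 2]},
      (2 * M).-lipschitz_(`]a, b[%classic) z &
      exists zbar : R -> R,
        {within `[a, b]%classic, continuous zbar} /\ {in `]a, b[, zbar =1 z}].
Proof.
move=> X z.
case: Omega_smooth => -[oA neA _] _.
case: u_torsion => -[g sg ug] lapu u0; case: phi_airy => -[psi spsi phipsi] airyu.
(* The extensions [g] of [u] and [psi] of [phi] are smooth on the whole plane. Since [Omega] is
   open, the derivatives agree on it and both equations pass to the extensions. *)
have ugA p : Omega p -> u p = g p.
  by move=> Ap; apply: ug; exact/mem_set/subset_closure.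
have phipsiA p : Omega p -> phi p = psi p.
  by move=> Ap; apply: phipsi; exact/mem_set/subset_closure.
have lapg p : Omega p -> laplacian g p = -1.
  move=> Ap; have := lapu p Ap.
  by rewrite /laplacian (eq_on_open_hess oA ugA Ap) => <-; rewrite opprK.
have g0 p : boundary Omega p -> g p = 0.
  by move=> bp; rewrite -(u0 p bp) ug//; apply/mem_set; case: bp.
have airy p : Omega p -> stress g p = (rotJ R)^T *m hess psi p *m rotJ R.
  move=> Ap; have sE : stress u p = stress g p.
    by rewrite /stress (eq_on_open_grad oA ugA Ap) (ugA p Ap).
  by rewrite -sE (airyu p Ap) (eq_on_open_hess oA phipsiA Ap).
pose P x := frame e x (y x).
have Py x : x \in `]a, b[ -> Omega (P x) /\ u (P x) = v x.
  by move=> /y_argmax[].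
have Ay x : x \in `]a, b[ -> Omega (frame e x (y x)) by move=> /Py[].
have vE x : x \in `]a, b[ -> v x = g (P x).
  by move=> /Py[Ap <-]; exact: ugA.
have ymax x t : x \in `]a, b[ -> Omega (frame e x t) ->
    g (frame e x t) <= g (frame e x (y x)).
  move=> xab At; rewrite -/(P x) -vE// -ugA//.
  by apply: (v_max x xab).2; exists t.
have yuniq x t : x \in `]a, b[ -> Omega (frame e x t) ->
    g (frame e x t) = g (frame e x (y x)) -> t = y x.
  move=> xab At gE; apply/esym/(y_argmax x xab).2; split=> //.
  by rewrite ugA// vE.
have gM p : Omega p -> g p <= M.
  by move=> Ap; rewrite -ugA//; apply: M_max.2; exists p.
have zE x : x \in `]a, b[ -> z x = - 'D_e psi (P x).
  move=> xab; rewrite /z /X (eq_on_open_grad oA phipsiA (Ay _ xab)).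
  rewrite derive_dotp; last exact: smooth_differentiable.
  by rewrite -scaleN1r dotpZl mulN1r.
have vP x : x \in `]a, b[ -> is_derive x 1 v ('D_e g (P x)).
  move=> xab; apply: (@near_eq_is_derive _ _ _ (fun t => g (P t))).
    by apply: filterS (near_in_itvoo xab) => t tab; rewrite vE.
  exact: (is_derive_ridge_max oA Omega_bounded sg lapg g0 e_unit Ay ymax yuniq).
pose dz x := 2 * v x - ('D_e g (P x)) ^+ 2.
have zP x : x \in `]a, b[ -> is_derive x 1 z (dz x).
  move=> xab; apply: (@near_eq_is_derive _ _ _ (fun t => - 'D_e psi (P t))).
    by apply: filterS (near_in_itvoo xab) => t tab; rewrite zE.
  rewrite /dz vE// -opprB; apply: is_deriveN.
  exact: (is_derive_ridge_airy oA Omega_bounded sg lapg g0 e_unit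
    Ay ymax yuniq spsi airy).
(* With [0 < g <= M] on the ridge and the squared slope between [0] and [2 * (M - g)], the value
   [dz x] lies between [4 * g - 2 * M] and [2 * g]. *)
have dz_le x : x \in `]a, b[ -> `|dz x| <= 2 * M.
  move=> xab; have Ap := Ay _ xab.
  have gpos := torsion_gt0 oA Omega_bounded sg lapg g0 Ap.
  have gradM : ('D_e g (P x)) ^+ 2 <= 2 * (M - g (P x)).
    apply: (ridge_gradient_bound oA Omega_bounded sg lapg g0 e_unit gM Ap).
    move=> q Aq; rewrite frame_dotl// => qx.
    rewrite -(frameK q e_unit) qx; apply: ymax => //.
    by rewrite -qx frameK.
  have := gM _ Ap; have := sqr_ge0 ('D_e g (P x)).
  by rewrite /dz vE// ler_norml; lra.
have M0 : 0 <= M.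
  case: neA => p Ap; have := gM p Ap.
  by have := torsion_gt0 oA Omega_bounded sg lapg g0 Ap; lra.
have lip : (2 * M).-lipschitz_(`]a, b[%classic) z.
  have H r s : r \in `]a, b[ -> s \in `]a, b[ -> r <= s ->
      `|z s - z r| <= 2 * M * `|s - r|.
    move=> rab sab rs.
    have sub t : t \in `[r, s] -> t \in `]a, b[.
      move: rab sab; rewrite !in_itv/= => /andP[ar _] /andP[_ sb] /andP[rt ts].
      by rewrite (lt_le_trans ar)// (le_lt_trans ts).
    have dzrs t : t \in `]r, s[ -> is_derive t 1 z (dz t).
      by move=> trs; apply/zP/sub/subset_itv_oo_cc.
    have cz : {within `[r, s], continuous z}.
      apply: continuous_in_subspaceT => t /set_mem/sub tab.
      apply/differentiable_continuous/derivable1_diffP.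
      by have [] := zP t tab.
    have [t /sub tab ->] := MVT_segment rs dzrs cz.
    by rewrite normrM ler_wpM2r// dz_le.
  move=> [r s] /= [rab sab].
  have [rs|sr] := orP (le_total r s); last exact: H.
  by rewrite distrC (distrC r); exact: H.
have ab0 : `]a, b[%classic !=set0.
  case: neA => p Ap; exists (dotp p e); rewrite -ab_proj.
  by exists (dotp p (rotJ R *m e)); rewrite frameK.
split.
- apply: lipschitz_locally; case: ab0 => c cab.
  have ? : ProperFilter (globally (`]a, b[%classic `*` `]a, b[%classic)).
    by apply: (@globally_properfilter _ _ (c, c)).
  exact: klipschitzW lip.
(* The formula holds at every point of the interval, so the exceptional set is empty. *)
- apply: aeW => x xab; have [dvx vx] := vP x xab; have [dzx zx] := zP x xab.
  by split; rewrite // !derive1E vx zx.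
- exact: lip.
(* The continuous extension to the closed interval is the restriction of one to the whole line. *)
- have [zb [czb zbE]] := lipschitz_extension ab0 (mulr_ge0 (ler0n R 2) M0) lip.
  exists zb; split; first exact: continuous_subspaceT.
  by move=> x xab; apply: zbE; exact/mem_set.
Qed.
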